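(* Let $d\geq 3$. (1) There are face-to-face tilings of $\mathbb{R}^d$ by convex polytopes that are $\lceil \frac{d}{2}\rceil$-periodic and monocoronal up to congruence. (2) There are face-to-face tilings of $\mathbb{R}^d$ by convex polytopes that are $\lceil \frac{d+1}{2}\rceil$-periodic and monocoronal up to rigid motions.
   Context: A tiling of $\mathbb{R}^d$ is a countable collection $\{T_1,T_2,\ldots\}$ of compact sets (the tiles), here convex polytopes, such that $\bigcup_i T_i=\mathbb{R}^d$ and the interiors of $T_i$ and $T_j$ are disjoint for $i\neq j$. It is face-to-face if the intersection of any two tiles is an entire face (possibly of dimension less than $d$, possibly empty) of both tiles. A vertex of a tiling is a point that is a vertex of at least one tile. The vertex corona of a vertex $x$ is the set of all tiles $T$ of the tiling with $x\in T$, together with the point $x$. Two subsets $A,B\subset\mathbb{R}^d$ are congruent if $A=t+RB$ for some $t\in\mathbb{R}^d$ and $R\in O(d)$, and directly congruent if $A=t+RB$ for some $t\in\mathbb{R}^d$ and $R\in SO(d)$. Vertex coronae of $x$ and $y$ are (directly) congruent if such an isometry maps $x$ to $y$ and the tiles of one corona onto the tiles of the other. A tiling is monocoronal up to congruence (resp. up to rigid motions) if all its vertex coronae are congruent (resp. directly congruent). The symmetry group of a tiling is the group of all isometries of $\mathbb{R}^d$ mapping the tiling to itself. A tiling is $k$-periodic if the maximal number of linearly independent translations in its symmetry group is exactly $k$. *)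

(* Defs.v *)
From HB Require Import structures.
From mathcomp Require Import all_boot all_order all_algebra.
From mathcomp Require Import all_classical all_reals all_analysis.
Set Implicit Arguments.
Unset Strict Implicit.
Unset Printing Implicit Defensive.
Import Order.TTheory GRing.Theory Num.Theory.
Import numFieldNormedType.Exports.
Local Open Scope classical_set_scope.
Local Open Scope ring_scope.

(* R^d is 'rV[R]_d.  Its library topology comes from the sup norm and is the
   usual one; distances and angles use the Euclidean structure below, since
   the library norm `| _ | on 'rV[R]_d is not Euclidean. *)
Section Tilings.
Variables (R : realType) (d : nat).
Implicit Types (x y a t v : 'rV[R]_d) (P F T : set 'rV[R]_d)
  (Q : 'M[R]_d) (TT : set (set 'rV[R]_d)).

Definition dotp x y : R := \sum_(i < d) x 0 i * y 0 i.
Definition enorm x : R := Num.sqrt (dotp x x).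

Definition conv_hull (s : seq 'rV[R]_d) : set 'rV[R]_d :=
  [set x | exists w : 'I_(size s) -> R,
    [/\ forall i, 0 <= w i,
        \sum_i w i = 1
      & x = \sum_i w i *: s`_i]].

(* A polytope of R^d is full-dimensional. *)
Definition convex_polytope P : Prop :=
  (exists s : seq 'rV[R]_d, P = conv_hull s) /\ P° !=set0.

(* Faces are cut out by valid inequalities; a = 0 gives the improper faces:
   P itself (b = 0) and the empty face (b = 1). *)
Definition face P F : Prop :=
  exists (a : 'rV[R]_d) (b : R),
    (forall x, P x -> dotp a x <= b) /\ F = P `&` [set x | dotp a x = b].

Definition polytope_vertex P x : Prop := face P [set x].

(* The collection is a set of tiles, so T_i and T_j with i != j are different
   elements of it. *)
Definition tiling TT : Prop :=
  [/\ countable TT,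
      forall T, TT T -> compact T,
      \bigcup_(T in TT) T = setT
    & forall T1 T2, TT T1 -> TT T2 -> T1 <> T2 -> T1° `&` T2° = set0].

Definition face_to_face TT : Prop :=
  forall T1 T2, TT T1 -> TT T2 ->
    face T1 (T1 `&` T2) /\ face T2 (T1 `&` T2).

Definition face_to_face_polytope_tiling TT : Prop :=
  [/\ tiling TT, forall T, TT T -> convex_polytope T & face_to_face TT].

Definition tiling_vertex TT x : Prop :=
  exists2 T, TT T & polytope_vertex T x.

Definition corona TT x : set (set 'rV[R]_d) := [set T | TT T /\ T x].

Definition orthogonal_group : set 'M[R]_d := [set Q | Q *m Q^T = 1%:M].
Definition special_orthogonal_group : set 'M[R]_d :=
  [set Q | orthogonal_group Q /\ \det Q = 1].

(* Points are row vectors, so the linear part acts on the right; both groups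
   above are closed under transposition. *)
Definition motion Q t x : 'rV[R]_d := t + x *m Q.

Definition coronae_congruent (G : set 'M[R]_d) TT x y : Prop :=
  exists Q t, [/\ G Q,
    motion Q t x = y
  & [set motion Q t @` T | T in corona TT x] = corona TT y].

Definition monocoronal (G : set 'M[R]_d) TT : Prop :=
  forall x y, tiling_vertex TT x -> tiling_vertex TT y ->
    coronae_congruent G TT x y.

Definition monocoronal_up_to_congruence := monocoronal orthogonal_group.
Definition monocoronal_up_to_rigid_motions :=
  monocoronal special_orthogonal_group.

Definition euclidean_isometry (f : 'rV[R]_d -> 'rV[R]_d) : Prop :=
  forall x y, enorm (f x - f y) = enorm (x - y).

Definition symmetry_group TT : set ('rV[R]_d -> 'rV[R]_d) :=
  [set f | euclidean_isometry f /\ [set f @` T | T in TT] = TT].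

Definition translation v x : 'rV[R]_d := v + x.

(* The rows of V are m linearly independent translation vectors of TT. *)
Definition independent_translations TT (m : nat) (V : 'M[R]_(m, d)) : Prop :=
  row_free V /\ forall i, symmetry_group TT (translation (row i V)).

Definition k_periodic (k : nat) TT : Prop :=
  (exists V : 'M[R]_(k, d), independent_translations TT V) /\
  (forall (m : nat) (V : 'M[R]_(m, d)),
     independent_translations TT V -> (m <= k)%N).

End Tilings.

(* Main.v *)
Require Import Defs.
From mathcomp Require Import all_boot all_order all_algebra.
From mathcomp Require Import all_classical all_reals all_analysis.
From mathcomp Require Import zify ring lra.

Set Implicit Arguments.
Unset Strict Implicit.
Unset Printing Implicit Defensive.
Import Order.TTheory GRing.Theory Num.Theory.
Import numFieldNormedType.Exports.
Local Open Scope classical_set_scope.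
Local Open Scope ring_scope.

(** The tilings are shears of the cubic tiling.  In the plane, cut R^2 into the
    horizontal strips n <= y <= n + 1, with n an integer, and each strip into
    parallelograms with horizontal sides of length 1 whose lower left corners
    are the integer points of the line y = n.  In the strips with n even the
    parallelograms are unit squares; in those with n odd they lean by 1 to the
    right or to the left, and the direction of each such strip can be chosen
    freely.  The tiling is face-to-face and its vertices are the integer points.
    A vertex lies between a strip of squares and a strip of leaning
    parallelograms, so its corona is determined, up to translation, by which of
    the two strips is the upper one and by the direction of the lean; the
    reflections of the two axes exchange the four cases.  With a non-periodic
    choice of directions all periods are horizontal.

    In dimension d take the product of m copies of this planar tiling with the
    cubic tiling of dimension d - 2m: coordinate i < m is sheared along
    coordinate d - 1 - i.  The result is (d - m)-periodic
    (sheared_tiling_periodic) and monocoronal up to congruence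
    (sheared_tiling_monocoronal).  If 2m < d, some coordinate takes part in no
    shear, the reflection of that coordinate corrects the determinant, and
    the coronae are directly congruent (sheared_tiling_monocoronal_direct).
    The two claims are the cases m = floor (d / 2) and
    m = floor ((d - 1) / 2).

    Each tile has affine coordinates lcoord in which it is the unit cube.
    These reduce all statements about one tile to the cube, and the
    intersection of two tiles to a product of conditions on single coordinates
    (tileI_slabs), each of which cuts out a face. *)

(** * Dot products, faces and convex hulls *)

Section DotProduct.
Variables (R : realType) (d : nat).
Implicit Types (x y a b : 'rV[R]_d) (P : set 'rV[R]_d).

Lemma dotpE a x : dotp a x = (a *m x^T) 0 0.
Proof. by rewrite mxE; apply: eq_bigr => i _; rewrite mxE. Qed.

Lemma dotpDr a x y : dotp a (x + y) = dotp a x + dotp a y.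
Proof. by rewrite !dotpE linearD mulmxDr mxE. Qed.

Lemma dotpZr a k x : dotp a (k *: x) = k * dotp a x.
Proof. by rewrite !dotpE linearZ -scalemxAr mxE. Qed.

Lemma dotpDl a b x : dotp (a + b) x = dotp a x + dotp b x.
Proof. by rewrite !dotpE mulmxDl mxE. Qed.

Lemma dotpZl k a x : dotp (k *: a) x = k * dotp a x.
Proof. by rewrite !dotpE -scalemxAl mxE. Qed.

Lemma dotpNl a x : dotp (- a) x = - dotp a x.
Proof. by rewrite -scaleN1r dotpZl mulN1r. Qed.

Lemma dotp0l x : dotp 0 x = 0.
Proof. by rewrite dotpE mul0mx mxE. Qed.

Lemma dotp_suml (I : finType) (a : I -> 'rV[R]_d) x :
  dotp (\sum_i a i) x = \sum_i dotp (a i) x.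
Proof.
by rewrite dotpE mulmx_suml summxE; apply: eq_bigr => i _; rewrite dotpE.
Qed.

Lemma dotp_sumr (I : finType) a (x : I -> 'rV[R]_d) :
  dotp a (\sum_i x i) = \sum_i dotp a (x i).
Proof.
rewrite dotpE linear_sum mulmx_sumr summxE.
by apply: eq_bigr => i _; rewrite dotpE.
Qed.

Lemma dotp_delta i x : dotp (delta_mx 0 i) x = x 0 i.
Proof. by rewrite dotpE -rowE !mxE. Qed.

Lemma face_bigcap (I : finType) P (F : I -> set 'rV[R]_d) :
  (forall i, face P (F i)) -> face P [set x | P x /\ forall i, F i x].
Proof.
move=> faceF.
have /choice[a ha] : forall i, exists ab : 'rV[R]_d * R,
    (forall x, P x -> dotp ab.1 x <= ab.2) /\
    F i = P `&` [set x | dotp ab.1 x = ab.2].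
  by move=> i; have [a [b h]] := faceF i; exists (a, b).
exists (\sum_i (a i).1), (\sum_i (a i).2); split.
  by move=> x Px; rewrite dotp_suml ler_sum// => i _; apply: (ha i).1.
apply/seteqP; split => x /= [Px Fx]; split => //.
  rewrite dotp_suml; apply: eq_bigr => i _.
  by have := Fx i; rewrite (ha i).2 => -[].
move=> i; rewrite (ha i).2; split=> //=; apply/eqP.
rewrite eq_sym -subr_eq0; apply/eqP.
have := @psumr_eq0P R I xpredT (fun i => (a i).2 - dotp (a i).1 x).
apply => // [k _|]; first by rewrite subr_ge0; apply: (ha k).1.
by rewrite sumrB -dotp_suml Fx subrr.
Qed.

(** An interior point of P can be moved inside P in both directions of any
    line. *)
Lemma interior_line P x v : P° x ->
  exists2 e : R, 0 < e & P (x + e *: v) /\ P (x - e *: v).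
Proof.
move=> Px.
have cont : (fun t : R => x + t *: v) @ (0 : R) --> x.
  suff: (fun t : R => x + t *: v) @ (0 : R) --> x + (0 : R) *: v.
    by rewrite scale0r addr0.
  apply: cvgD; first exact: cvg_cst.
  by apply: cvgZr_tmp; exact: cvg_id.
have /nbhs_ballP[e /= e0 he] := cont _ Px.
exists (e / 2); first by rewrite divr_gt0.
rewrite -scaleNr; split; apply: he; rewrite -ball_normE /= sub0r ?opprK ?normrN.
  by rewrite gtr0_norm ?divr_gt0// ltr_pdivrMr// ltr_pMr// ltr1n.
by rewrite gtr0_norm ?divr_gt0// ltr_pdivrMr// ltr_pMr// ltr1n.
Qed.

(** Convex combinations of a family of points indexed by a finite type; i0
    only provides a default value for nth. *)
Lemma conv_hull_map (I : finType) (i0 : I) (f : I -> 'rV[R]_d) (w : I -> R) :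
  (forall i, 0 <= w i) -> \sum_i w i = 1 ->
  conv_hull [seq f i | i <- enum I] (\sum_i w i *: f i).
Proof.
move=> w0 w1.
have sumE (V : nmodType) (F : I -> V) :
    \sum_i F i = \sum_(k < size [seq f i | i <- enum I])
                    F (nth i0 (enum I) k).
  by rewrite size_map -big_enum (big_nth i0) big_mkord.
exists (fun k => w (nth i0 (enum I) k)); split => //.
  by rewrite -(sumE R w).
rewrite sumE; apply: eq_bigr => k _.
congr (_ *: _); apply/esym/nth_map.
by have := ltn_ord k; rewrite {2}size_map.
Qed.

End DotProduct.

(** * Slopes *)

(** The horizontal displacement from the lower to the upper side of the
    parallelograms in the strip n <= y <= n + 1.  The odd strips lean to the
    right for n > 0 and to the left for n < 0, which is not periodic. *)
Definition slope (n : int) : int :=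
  if (2 %| n)%Z then 0 else if 0 < n then 1 else -1.

Lemma slope_aperiodic (N : int) :
  (forall n, slope (n + N) = slope n) -> N = 0.
Proof.
move=> h; have := h 1; have := h (- 1).
have -> : slope 1 = 1 by [].
have -> : slope (- 1) = - 1 by [].
by rewrite /slope; do ?case: ifP; lia.
Qed.

Lemma slope_le1 n : -1 <= slope n <= 1.
Proof. by rewrite /slope; do 2?case: ifP. Qed.

(** * Tiles and their affine coordinates *)

Section ShearedTiling.
Variables (R : realType) (d m : nat).
Hypothesis m2d : (m.*2 <= d)%N.
Implicit Types (c p q : 'rV[int]_d) (x u z : 'rV[R]_d) (i j k : 'I_d).

(** The slope of the tile c in direction i.  Coordinate i < m is sheared along
    the partner coordinate rev_ord i = d - 1 - i, which is itself unsheared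
    since 2m <= d; the coordinates i >= m are unsheared. *)
Definition shear c i : int :=
  if (i < m)%N then slope (c 0 (rev_ord i)) else 0.

(** The affine coordinates of R^d in which the tile c is the unit cube. *)
Definition lcoord c x i : R :=
  x 0 i - (c 0 i)%:~R
  - (shear c i)%:~R * (x 0 (rev_ord i) - (c 0 (rev_ord i))%:~R).

(** The tile whose corner with all affine coordinates 0 is the integer point
    c. *)
Definition tile c : set 'rV[R]_d := [set x | forall i, 0 <= lcoord c x i <= 1].

(** The point whose affine coordinates with respect to the tile c are u. *)
Definition tpoint c u : 'rV[R]_d :=
  \row_i ((c 0 i)%:~R + u 0 i + (shear c i)%:~R * u 0 (rev_ord i)).

(** The product of m sheared planar tilings with the cubic tiling of dimension
    d - 2m. *)
Definition sheared_tiling : set (set 'rV[R]_d) := range tile.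

Lemma rev_ltm i : (i < m)%N -> (m <= rev_ord i)%N.
Proof. by move=> im; rewrite /=; have := ltn_ord i; move: m2d; lia. Qed.

Lemma shear0 c i : (m <= i)%N -> shear c i = 0.
Proof. by rewrite /shear ltnNge => ->. Qed.

Lemma shear_le1 c i : -1 <= shear c i <= 1.
Proof. by rewrite /shear; case: ifP => // _; exact: slope_le1. Qed.

Lemma shear_cases c i : shear c i = 0 \/ shear c (rev_ord i) = 0.
Proof.
have [im|im] := ltnP i m; last by left; exact: shear0.
by right; apply/shear0/rev_ltm.
Qed.

Lemma lcoord_unsheared c x i : (m <= i)%N -> lcoord c x i = x 0 i - (c 0 i)%:~R.
Proof. by move=> mi; rewrite /lcoord shear0// mul0r subr0. Qed.

Lemma lcoord_tpoint c u i : lcoord c (tpoint c u) i = u 0 i.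
Proof.
rewrite /lcoord !mxE rev_ordK.
by case: (shear_cases c i) => ->; ring.
Qed.

Lemma tpointK c x : tpoint c (\row_i lcoord c x i) = x.
Proof.
apply/rowP => i; rewrite !mxE /lcoord rev_ordK.
by case: (shear_cases c i) => ->; ring.
Qed.

Lemma tile_tpoint c u : (forall i, 0 <= u 0 i <= 1) -> tile c (tpoint c u).
Proof. by move=> hu i; rewrite lcoord_tpoint. Qed.

Lemma lcoord_inj c x y : (forall i, lcoord c x i = lcoord c y i) -> x = y.
Proof.
move=> h; rewrite -(tpointK c x) -(tpointK c y); congr tpoint.
by apply/rowP => i; rewrite !mxE.
Qed.

(** The edge vector of the tile c along its i-th affine coordinate. *)
Definition edge c i : 'rV[R]_d := tpoint c (delta_mx 0 i) - tpoint c 0.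

Lemma lcoord_edge c x i t k :
  lcoord c (x + t *: edge c i) k = lcoord c x k + t * (k == i)%:R.
Proof.
rewrite /lcoord !mxE /= rev_ordK.
by case: (shear_cases c k) => ->; ring.
Qed.

(** The affine functional lcoord c _ i has linear part lfun c i and constant
    term - loff c i. *)
Definition lfun c i : 'rV[R]_d :=
  delta_mx 0 i - (shear c i)%:~R *: delta_mx 0 (rev_ord i).

Definition loff c i : R :=
  (c 0 i)%:~R - (shear c i)%:~R * (c 0 (rev_ord i))%:~R.

Lemma lcoordE c x i : lcoord c x i = dotp (lfun c i) x - loff c i.
Proof.
by rewrite dotpDl dotpNl dotpZl !dotp_delta /lcoord /loff; ring.
Qed.

(** * Tiles are polytopes *)

Lemma lcoord_conv c (I : finType) (w : I -> R) (f : I -> 'rV[R]_d) i :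
  \sum_k w k = 1 ->
  lcoord c (\sum_k w k *: f k) i = \sum_k w k * lcoord c (f k) i.
Proof.
move=> w1; rewrite lcoordE dotp_sumr -[loff c i]mul1r -w1 mulr_suml -sumrB.
by apply: eq_bigr => k _; rewrite dotpZr lcoordE [RHS]mulrBr.
Qed.

Lemma conv_hull_tile c (s : seq 'rV[R]_d) : (forall x, x \in s -> tile c x) ->
  conv_hull s `<=` tile c.
Proof.
move=> hs _ [w [w0 w1 ->]] i; rewrite lcoord_conv//.
have st (k : 'I_(size s)) : 0 <= lcoord c s`_k i <= 1.
  by apply: hs; rewrite mem_nth.
apply/andP; split.
  by apply: sumr_ge0 => k _; rewrite mulr_ge0//; case/andP: (st k).
rewrite -w1 ler_sum// => k _; rewrite ler_piMr//.
by case/andP: (st k).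
Qed.

(** The vertex of the tile c whose affine coordinates are the bits of e. *)
Definition corner c (e : {ffun 'I_d -> bool}) : 'rV[R]_d :=
  tpoint c (\row_i (e i)%:R).

(** The weight of the vertex e of the unit cube when the point u of the cube
    is written, by multilinear interpolation, as a convex combination of the
    vertices. *)
Definition cube_weight u (e : {ffun 'I_d -> bool}) : R :=
  \prod_i (if e i then u 0 i else 1 - u 0 i).

Lemma sum_cube_weight u : \sum_e cube_weight u e = 1.
Proof.
have /= <- := bigA_distr_bigA
  (fun i (b : bool) => if b then u 0 i else 1 - u 0 i).
by rewrite big1// => i _; rewrite big_bool /= addrC subrK.
Qed.

Lemma sum_cube_weight_coord u j :
  \sum_e cube_weight u e * (e j)%:R = u 0 j.
Proof.
(* the factor b%:R at i = j turns the weight of e into its product with e j *)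
pose F i (b : bool) : R :=
  (if b then u 0 i else 1 - u 0 i) * (if i == j then b%:R else 1).
transitivity (\sum_(e : {ffun 'I_d -> bool}) \prod_i F i (e i)).
  apply: eq_bigr => e _; rewrite /F big_split /=; congr (_ * _).
  by rewrite -big_mkcond big_pred1_eq.
rewrite -bigA_distr_bigA (bigD1 j)//= [X in _ * X]big1 ?mulr1.
  by rewrite big_bool /F eqxx /= !mulr1 mulr0 addr0.
move=> i ij; rewrite big_bool /F (negPf ij) /= !mulr1.
by rewrite addrC subrK.
Qed.

Lemma tile_conv_hull c :
  tile c = conv_hull [seq corner c e | e <- enum {ffun 'I_d -> bool}].
Proof.
apply/seteqP; split => [x tx|]; last first.
  apply: conv_hull_tile => _ /mapP[e _ ->].
  by apply: tile_tpoint => i; rewrite mxE; case: (e i); rewrite ?lexx ?ler01.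
pose u := \row_i lcoord c x i.
have -> : x = \sum_e cube_weight u e *: corner c e.
  apply: (@lcoord_inj c) => i; rewrite lcoord_conv ?sum_cube_weight//.
  under eq_bigr do rewrite lcoord_tpoint mxE.
  by rewrite sum_cube_weight_coord mxE.
apply: (conv_hull_map [ffun=> false]); last exact: sum_cube_weight.
move=> e; apply: prodr_ge0 => i _; rewrite mxE.
by have /andP[] := tx i; case: (e i) => // _; rewrite subr_ge0.
Qed.

Lemma tile_interior_neq0 c : (tile c)° !=set0.
Proof.
pose o := tpoint c (const_mx (2^-1)).
exists o; apply/nbhs_ballP; exists (4^-1) => /=; first by rewrite invr_gt0.
move=> y hy i.
have -> : lcoord c y i = 2^-1 - ((o 0 i - y 0 i)
    - (shear c i)%:~R * (o 0 (rev_ord i) - y 0 (rev_ord i))).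
  have := lcoord_tpoint c (const_mx 2^-1) i; rewrite -/o mxE => <-.
  by rewrite /lcoord; ring.
have h k : `|o 0 k - y 0 k| < 4^-1.
  by have [_ /(_ 0 k)] := hy; rewrite -ball_normE.
have := h i; have := h (rev_ord i); rewrite !ltr_norml.
have := shear_le1 c i; set s := shear c i => hs.
have [->|[->|->]] : s = 0 \/ s = 1 \/ s = -1 by lia.
- lra.
- lra.
- lra.
Qed.

Lemma tile_polytope c : convex_polytope (tile c).
Proof.
split; last exact: tile_interior_neq0.
by eexists; exact: tile_conv_hull.
Qed.

Lemma interior_lcoord c x i : (tile c)° x -> 0 < lcoord c x i < 1.
Proof.
move=> /(@interior_line _ _ _ _ (edge c i))[e e0 [/(_ i) h1 /(_ i)]].
by move: h1; rewrite -scaleNr !lcoord_edge eqxx /= !mulr1; lra.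
Qed.

(** If the i-th affine coordinate of x were strictly between 0 and 1, a
    functional maximal at x would be constant along the edge i, and its face
    would contain more than x. *)
Lemma vertex_lcoord c x i : polytope_vertex (tile c) x ->
  lcoord c x i = 0 \/ lcoord c x i = 1.
Proof.
move=> [a [b [hab E]]].
have [tx ax] : (tile c `&` [set x | dotp a x = b]) x by rewrite -E.
have /andP[] := tx i.
rewrite le_eqVlt => /predU1P[<-|u0]; first by left.
rewrite le_eqVlt => /predU1P[->|u1]; first by right.
pose t := Num.min (lcoord c x i) (1 - lcoord c x i).
have t0 : 0 < t by rewrite lt_min u0 subr_gt0.
have tl : t <= lcoord c x i by rewrite ge_min lexx.
have tr : t <= 1 - lcoord c x i by rewrite ge_min lexx orbT.
have ht (s : R) : `|s| <= t -> tile c (x + s *: edge c i).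
  rewrite ler_norml => hs k; rewrite lcoord_edge.
  have [->|_] := eqVneq k i; first by rewrite mulr1; lra.
  by rewrite mulr0 addr0; exact: tx.
have t1 : tile c (x + t *: edge c i) by apply: ht; rewrite gtr0_norm.
have t2 : tile c (x + (- t) *: edge c i).
  by apply: ht; rewrite normrN gtr0_norm.
have := hab _ t1; have := hab _ t2; rewrite !dotpDr !dotpZr => h1 h2.
have : [set x] (x + t *: edge c i).
  by rewrite E; split => //=; rewrite dotpDr dotpZr; move: ax => /=; lra.
move=> /= h; have := lcoord_edge c x i t i; rewrite h eqxx mulr1; lra.
Qed.

(** * The tiles form a face-to-face tiling *)

Lemma lcoord_continuous c i : continuous (lcoord c ^~ i).
Proof.
move=> x; rewrite /lcoord.
have cB k (a : R) : {for x, continuous (fun y : 'rV[R]_d => y 0 k - a)}.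
  by apply: continuousB; [exact: coord_continuous|exact: cst_continuous].
apply: (@cvgB _ _ _ (nbhs x)); first exact: cB.
by apply: (@cvgMl_tmp _ _ (nbhs x)); exact: cB.
Qed.

Lemma tile_compact c : compact (tile c).
Proof.
(* the i-th coordinate stays in [c_i - 1, c_i + 2] because the slopes are at
   most 1 in absolute value *)
pose A i : set R := `[(c 0 i)%:~R - 1, (c 0 i)%:~R + 2]%classic.
have cA : compact [set x : 'rV[R]_d | forall i, A i (x 0 i)].
  by apply: rV_compact => i; exact: segment_compact.
apply: (subclosed_compact _ cA).
  have -> : tile c = \bigcap_i (lcoord c ^~ i @^-1` `[0, 1]%classic).
    by apply/seteqP; split => [x tx i _|x tx i]; have := tx i;
      rewrite /= in_itv/=; auto.
  apply: closed_bigI => i _; apply: preimage_closed; last exact: itv_closed.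
  by move=> x _; exact: lcoord_continuous.
move=> x tx i; rewrite /A /= in_itv/=.
rewrite -(tpointK c x) !mxE.
have := tx i; have := tx (rev_ord i).
have := shear_le1 c i; set s := shear c i => hs.
have [->|[->|->]] : s = 0 \/ s = 1 \/ s = -1 by lia.
- lra.
- lra.
- lra.
Qed.

Lemma tile_cover x : exists c, tile c x.
Proof.
(* the unsheared coordinates determine the slopes, and c0 is already correct
   on them *)
pose c0 : 'rV[int]_d := \row_i Num.floor (x 0 i).
pose c : 'rV[int]_d := \row_i Num.floor
  (x 0 i - (shear c0 i)%:~R * (x 0 (rev_ord i) - (c0 0 (rev_ord i))%:~R)).
have cc0 k : (m <= k)%N -> c 0 k = c0 0 k.
  by move=> mk; rewrite !mxE shear0// mul0r subr0.
exists c => i.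
have -> : lcoord c x i = x 0 i - (shear c0 i)%:~R *
    (x 0 (rev_ord i) - (c0 0 (rev_ord i))%:~R) - (c 0 i)%:~R.
  rewrite /lcoord; have [im|mi] := ltnP i m; last by rewrite !shear0//; ring.
  by rewrite /shear im (cc0 (rev_ord i)) ?rev_ltm//; ring.
set y := _ - _ * _; rewrite mxE -/y.
have := floor_le y; have := floorD1_gt y.
rewrite intrD; lra.
Qed.

Lemma int_eq_of_overlap (a b : int) (y : R) :
  0 < y - a%:~R < 1 -> 0 < y - b%:~R < 1 -> a = b.
Proof.
move=> h1 h2.
have : (a%:~R : R) < (b + 1)%:~R by rewrite intrD; lra.
have : (b%:~R : R) < (a + 1)%:~R by rewrite intrD; lra.
by rewrite !ltr_int; lia.
Qed.

Lemma interior_tile_inj c c' x : (tile c)° x -> (tile c')° x -> c = c'.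
Proof.
move=> tx tx'.
have E k : (m <= k)%N -> c 0 k = c' 0 k.
  move=> mk; have := interior_lcoord k tx; have := interior_lcoord k tx'.
  rewrite !lcoord_unsheared// => h h'.
  exact: int_eq_of_overlap h' h.
apply/rowP => i; have [im|mi] := ltnP i m; last exact: E.
have := interior_lcoord i tx; have := interior_lcoord i tx'.
rewrite /lcoord /shear im (E (rev_ord i)) ?rev_ltm// => h h'.
pose y := x 0 i - (slope (c' 0 (rev_ord i)))%:~R *
  (x 0 (rev_ord i) - (c' 0 (rev_ord i))%:~R).
by apply: (int_eq_of_overlap (y := y)); rewrite /y; lra.
Qed.

Lemma sheared_tiling_tiling : tiling sheared_tiling.
Proof.
split.
- exact: sub_countable (card_image_le _ _) (countableP _).
- by move=> _ [c _ <-]; exact: tile_compact.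
- apply/seteqP; split => // x _; have [c tx] := tile_cover x.
  by exists (tile c) => //; exists c.
- move=> _ _ [c _ <-] [c' _ <-] cc'; apply/eqP/negPn/negP => /set0P[x [tx tx']].
  by apply: cc'; rewrite (interior_tile_inj tx tx').
Qed.

(** The cube meets the slab e <= u_i <= e + 1, e an integer, in the whole cube,
    in a facet, or not at all. *)
Lemma slab_face c i (e : int) :
  face (tile c) [set x | tile c x /\ e%:~R <= lcoord c x i <= e%:~R + 1].
Proof.
have [e0|[e1|[eN1|e2]]] :
    e = 0 \/ e = 1 \/ e = -1 \/ (e <= -2 \/ 2 <= e) by lia.
- exists 0, 0; split=> [x _|]; first by rewrite dotp0l.
  apply/seteqP; split => x /= [tx h]; split => //; first by rewrite dotp0l.
  by rewrite e0 add0r; exact: tx.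
- have {}e1 : e%:~R = 1 :> R by rewrite e1.
  exists (lfun c i), (1 + loff c i); split=> [x /(_ i)|].
    by rewrite lcoordE; lra.
  apply/seteqP; split => x /= [tx]; have := tx i;
    rewrite e1 lcoordE => h1 h2; split=> //; lra.
- have {}eN1 : e%:~R = -1 :> R by rewrite eN1.
  exists (- lfun c i), (- loff c i); split=> [x /(_ i)|].
    by rewrite dotpNl lcoordE; lra.
  apply/seteqP; split => x /= [tx]; have := tx i;
    rewrite eN1 dotpNl lcoordE => h1 h2; split=> //; lra.
- exists 0, 1; split=> [x _|]; first by rewrite dotp0l ler01.
  apply/seteqP; split => x /= [tx]; last by rewrite dotp0l; lra.
  have [h|h] : (e%:~R <= -2 :> R) \/ (2 <= e%:~R :> R).
    by case: e2 => h; [left|right]; move: h; rewrite -(ler_int R) ?rmorphN.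
    by have := tx i; lra.
  by have := tx i; lra.
Qed.

(** On the intersection of the tiles c and c', their i-th affine coordinates
    differ by offset c c' i.  The difference is constant there: either the
    partner coordinates of c and c' agree, and so do the slopes, or the tiles
    meet only in the hyperplane where one strip ends and the other begins. *)
Definition offset c c' i : int :=
  if (i < m)%N then
    let j := rev_ord i in
    if c 0 j == c' 0 j then c' 0 i - c 0 i
    else if c 0 j < c' 0 j then c' 0 i - c 0 i - shear c i
    else c' 0 i + shear c' i - c 0 i
  else c' 0 i - c 0 i.

Lemma tileI_slabs c c' :
  tile c `&` tile c' = [set x | tile c x /\ forall i,
     tile c x /\ (offset c c' i)%:~R <= lcoord c x i
                 <= (offset c c' i)%:~R + 1].
Proof.
(* only the unsheared coordinates of x need to lie in the range of c' *)
have key x i : tile c x -> (forall j, (m <= j)%N ->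
     0 <= x 0 j - (c' 0 j)%:~R <= 1) ->
   lcoord c' x i = lcoord c x i - (offset c c' i)%:~R.
  move=> tx h; have [im|mi] := ltnP i m; last first.
    by rewrite !lcoord_unsheared// /offset ltnNge mi /=; ring.
  have := tx (rev_ord i); rewrite lcoord_unsheared ?rev_ltm//.
  have := h _ (rev_ltm im).
  rewrite /lcoord /offset im; set j := rev_ord i => h1 h2.
  case: ifP => [/eqP E|nE]; first by rewrite /shear im -/j E; ring.
  case: ifP => [lt|nlt].
    have lt1 : ((c 0 j + 1)%:~R : R) <= (c' 0 j)%:~R by rewrite ler_int; lia.
    have x1 : x 0 j = (c' 0 j)%:~R by move: lt1; rewrite intrD; lra.
    have x2 : (c' 0 j)%:~R = (c 0 j)%:~R + 1 :> R.
      by move: lt1; rewrite intrD; lra.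
    by rewrite x1 x2; ring.
  have lt1 : ((c' 0 j + 1)%:~R : R) <= (c 0 j)%:~R by rewrite ler_int; lia.
  have x1 : x 0 j = (c 0 j)%:~R by move: lt1; rewrite intrD; lra.
  have x2 : (c 0 j)%:~R = (c' 0 j)%:~R + 1 :> R.
    by move: lt1; rewrite intrD; lra.
  by rewrite x1 x2; ring.
apply/seteqP; split => x /= [tx h]; split=> // i.
  split=> //; have := h i; rewrite key//; first lra.
  by move=> j mj; have := h j; rewrite lcoord_unsheared.
rewrite key//; first by have := (h i).2; lra.
move=> j mj; have := (h j).2.
by rewrite lcoord_unsheared// /offset ltnNge mj /= intrB; lra.
Qed.

Lemma sheared_tiling_face_to_face : face_to_face sheared_tiling.
Proof.
have F c c' : face (tile c) (tile c `&` tile c').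
  by rewrite tileI_slabs; apply: face_bigcap => i; exact: slab_face.
by move=> _ _ [c _ <-] [c' _ <-]; split; last rewrite setIC.
Qed.

Lemma sheared_tiling_polytope_tiling :
  face_to_face_polytope_tiling sheared_tiling.
Proof.
split; [exact: sheared_tiling_tiling| |exact: sheared_tiling_face_to_face].
by move=> _ [c _ <-]; exact: tile_polytope.
Qed.

(** * Vertex coronae *)

(** The integer point p as a point of R^d. *)
Definition intpt p : 'rV[R]_d := map_mx intr p.

Lemma sheared_tiling_vertex_int x :
  tiling_vertex sheared_tiling x -> exists p, x = intpt p.
Proof.
move=> [_ [c _ <-] vx].
have [e eE] : exists e : 'rV[int]_d, forall k, (e 0 k)%:~R = lcoord c x k.
  exists (\row_i (lcoord c x i == 1)%:R) => k.
  rewrite mxE; have [->|->] := vertex_lcoord k vx; last by rewrite eqxx.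
  by rewrite eq_sym oner_eq0.
exists (\row_i (c 0 i + e 0 i + shear c i * e 0 (rev_ord i))).
rewrite -[LHS](tpointK c); apply/rowP => i.
by rewrite !mxE !rmorphD rmorphM/= !eE.
Qed.

(** The isometry of the line that maps a to b and has linear part s = 1 or -1
    maps [n, n + 1] onto [n', n' + 1] with n' = flip s a b n. *)
Definition flip (s a b n : int) : int := b + s * (n - a) - (s == -1)%:R.

(** The signs s are such that the isometry with linear part diag(s) and mapping
    the vertex p to the vertex q matches the slopes of the two strips adjacent
    to p, in each sheared plane, with those of the strips adjacent to q. *)
Definition compatible p q (s : 'I_d -> int) : Prop :=
  (forall i, s i = 1 \/ s i = -1) /\
  (forall i, (i < m)%N -> forall n,
     n = p 0 (rev_ord i) \/ n = p 0 (rev_ord i) - 1 ->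
     slope (flip (s (rev_ord i)) (p 0 (rev_ord i)) (q 0 (rev_ord i)) n) =
     s i * s (rev_ord i) * slope n).

Lemma compatible_sym p q s : compatible p q s -> compatible q p s.
Proof.
move=> [s1 h]; split=> // i im n hn.
have := h i im (flip (s (rev_ord i)) (q 0 (rev_ord i)) (p 0 (rev_ord i)) n).
have K : flip (s (rev_ord i)) (p 0 (rev_ord i)) (q 0 (rev_ord i))
    (flip (s (rev_ord i)) (q 0 (rev_ord i)) (p 0 (rev_ord i)) n) = n.
  by rewrite /flip; have [->|->] := s1 (rev_ord i); rewrite ?eqxx /=; lia.
rewrite K => ->.
  by have [->|->] := s1 i; have [->|->] := s1 (rev_ord i); lia.
by rewrite /flip; have [->|->] := s1 (rev_ord i); rewrite ?eqxx /=; lia.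
Qed.

(** The diagonal matrix with diagonal s. *)
Definition signmx (s : 'I_d -> int) : 'M[R]_d := diag_mx (\row_i (s i)%:~R).

(** The isometry with linear part diag(s) that maps p to q. *)
Definition corona_map (s : 'I_d -> int) p q : 'rV[R]_d -> 'rV[R]_d :=
  motion (signmx s) (intpt q - intpt p *m signmx s).

Lemma corona_mapE s p q z i :
  corona_map s p q z 0 i = (q 0 i)%:~R + (s i)%:~R * (z 0 i - (p 0 i)%:~R).
Proof.
by rewrite /corona_map /motion /signmx !mul_mx_diag !mxE; ring.
Qed.

Lemma corona_map_center s p q : corona_map s p q (intpt p) = intpt q.
Proof. by apply/rowP => i; rewrite corona_mapE !mxE subrr mulr0 addr0. Qed.

Lemma corona_mapK s p q : (forall i, s i = 1 \/ s i = -1) ->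
  cancel (corona_map s p q) (corona_map s q p).
Proof.
move=> s1 z; apply/rowP => i; rewrite !corona_mapE.
by have [->|->] := s1 i; rewrite ?rmorphN /=; ring.
Qed.

(** The index of the image of the tile c under corona_map s p q.  When the
    partner of coordinate i is reversed, the upper side of the tile becomes the
    lower one, which explains the added shear. *)
Definition corona_index (s : 'I_d -> int) p q c : 'rV[int]_d :=
  \row_i flip (s i) (p 0 i) (q 0 i)
           (c 0 i + (s (rev_ord i) == -1)%:R * shear c i).

(** The map preserves each affine coordinate u_i or replaces it by 1 - u_i. *)
Lemma corona_map_lcoord s p q c z i :
  compatible p q s -> tile c (intpt p) ->
  lcoord (corona_index s p q c) (corona_map s p q z) i =
  if s i == 1 then lcoord c z i else 1 - lcoord c z i.
Proof.
move=> [s1 cpt] tp.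
have [im|mi] := ltnP i m; last first.
  rewrite !lcoord_unsheared// corona_mapE mxE /flip shear0// mulr0 addr0.
  by have [->|->] := s1 i; rewrite ?eqxx /=
    !rmorphB !rmorphD !rmorphM /= ?rmorphB ?rmorphN /=; ring.
have mj := rev_ltm im.
have Ec : corona_index s p q c 0 (rev_ord i) =
    flip (s (rev_ord i)) (p 0 (rev_ord i)) (q 0 (rev_ord i)) (c 0 (rev_ord i)).
  by rewrite mxE (shear0 _ mj) mulr0 addr0.
have hc : c 0 (rev_ord i) = p 0 (rev_ord i) \/
          c 0 (rev_ord i) = p 0 (rev_ord i) - 1.
  have := tp (rev_ord i); rewrite lcoord_unsheared// mxE -intrB.
  by rewrite ler0z -[1]/(1%:~R) ler_int; lia.
have Es : shear (corona_index s p q c) i = s i * s (rev_ord i) * shear c i.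
  by rewrite /shear im Ec cpt.
rewrite /lcoord Es Ec !corona_mapE mxE /flip; move: (shear c i) => S.
by have [->|->] := s1 i; have [->|->] := s1 (rev_ord i); rewrite ?eqxx /=;
  rewrite !(rmorphB, rmorphD, rmorphM, rmorphN) /=; ring.
Qed.

Lemma corona_map_tile s p q c :
  compatible p q s -> tile c (intpt p) ->
  corona_map s p q @` tile c = tile (corona_index s p q c).
Proof.
move=> cpt tp.
have E z : tile (corona_index s p q c) (corona_map s p q z) <-> tile c z.
  split=> tz i; have := tz i; rewrite corona_map_lcoord//; case: ifP => _; lra.
apply/seteqP; split => [_ [z tz <-]|z tz]; first exact/E.
have zK := corona_mapK q p cpt.1 z.
exists (corona_map s q p z); last exact: zK.
by apply: (E _).1; rewrite zK.
Qed.

Lemma corona_map_corona s p q T :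
  compatible p q s -> corona sheared_tiling (intpt p) T ->
  corona sheared_tiling (intpt q) (corona_map s p q @` T).
Proof.
move=> cpt [[c _ <-] tp]; split.
  by rewrite corona_map_tile//; exists (corona_index s p q c).
by exists (intpt p) => //; exact: corona_map_center.
Qed.

Lemma compatible_congruent (G : set 'M[R]_d) s p q :
  compatible p q s -> G (signmx s) ->
  coronae_congruent G sheared_tiling (intpt p) (intpt q).
Proof.
move=> cpt Gs; exists (signmx s), (intpt q - intpt p *m signmx s).
split=> //; first exact: corona_map_center.
apply/seteqP; split => [_ [T cT <-]|T cT]; first exact: corona_map_corona.
exists (corona_map s q p @` T).
  exact: corona_map_corona (compatible_sym cpt) cT.
suff: corona_map s p q @` (corona_map s q p @` T) = T by [].
rewrite image_comp.
have -> : corona_map s p q \o corona_map s q p = id.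
  by apply/funext => z; exact: (corona_mapK q p cpt.1).
by rewrite image_id.
Qed.

Lemma signmx_orthogonal s : (forall i, s i = 1 \/ s i = -1) ->
  orthogonal_group (signmx s).
Proof.
move=> s1; rewrite /orthogonal_group /= /signmx tr_diag_mx mulmx_diag.
rewrite -[RHS]diag_const_mx; congr diag_mx; apply/rowP => i; rewrite !mxE.
by have [->|->] := s1 i; rewrite ?rmorphN /= ?mulrNN mulr1.
Qed.

Lemma det_signmx s : \det (signmx s) = (\prod_i s i)%:~R.
Proof. by rewrite det_diag rmorph_prod; apply: eq_bigr => i _; rewrite mxE. Qed.

(** The sign that the isometry must have on the axis across the strips: it
    exchanges the lower and the upper strip unless a and b have the same
    parity. *)
Definition parity_sign (a b : int) : int := if (2 %| a - b)%Z then 1 else -1.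

(** The slope of the one leaning strip adjacent to the line y = n; the other
    adjacent strip has slope 0. *)
Definition nearby_slope (n : int) : int := slope (n - 1) + slope n.

Lemma nearby_slope_sign n : nearby_slope n = 1 \/ nearby_slope n = -1.
Proof. by rewrite /nearby_slope /slope; do ?case: ifP; lia. Qed.

Lemma slope_nearby a n : n = a \/ n = a - 1 ->
  slope n = if (2 %| n)%Z then 0 else nearby_slope a.
Proof.
case=> ->; rewrite /nearby_slope /slope; case: ifP => //.
  by case: (ifP (2 %| a - 1)%Z); do ?case: ifP; lia.
by case: (ifP (2 %| a)%Z); do ?case: ifP; lia.
Qed.

Lemma slope_flip a b n : n = a \/ n = a - 1 ->
  slope (flip (parity_sign a b) a b n) =
  nearby_slope a * nearby_slope b * slope n.
Proof.
move=> hn; set n' := flip _ _ _ _.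
have hn' : n' = b \/ n' = b - 1.
  by rewrite /n' /parity_sign /flip; case: ifP => _; rewrite ?eqxx /=; lia.
have e : (2 %| n')%Z = (2 %| n)%Z.
  by rewrite /n' /parity_sign /flip; case: ifP; rewrite ?eqxx /=; lia.
rewrite (slope_nearby hn) (slope_nearby hn') e; case: ifP => _; first lia.
by case: (nearby_slope_sign a) => ->; lia.
Qed.

Lemma parity_sign_sign a b : parity_sign a b = 1 \/ parity_sign a b = -1.
Proof. by rewrite /parity_sign; case: ifP; auto. Qed.

Lemma compatible_exists p q : exists s, compatible p q s.
Proof.
pose t j := parity_sign (p 0 j) (q 0 j).
exists (fun i => if (i < m)%N then t (rev_ord i) *
  (nearby_slope (p 0 (rev_ord i)) * nearby_slope (q 0 (rev_ord i))) else t i).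
split=> i; last first.
  move=> im n hn; rewrite im ltnNge rev_ltm//= /t slope_flip//.
  by have [->|->] := parity_sign_sign (p 0 (rev_ord i)) (q 0 (rev_ord i)); lia.
rewrite /t; case: ifP => _; last exact: parity_sign_sign.
have [->|->] := parity_sign_sign (p 0 (rev_ord i)) (q 0 (rev_ord i));
  have [->|->] := nearby_slope_sign (p 0 (rev_ord i));
  by have [->|->] := nearby_slope_sign (q 0 (rev_ord i)); auto.
Qed.

Lemma prod_sign (s : 'I_d -> int) : (forall i, s i = 1 \/ s i = -1) ->
  \prod_(i < d) s i = 1 \/ \prod_(i < d) s i = -1.
Proof.
move=> s1; elim/big_ind: _ => [|a b|i _]; [by left| |exact: s1].
by move=> [->|->] [->|->]; auto.
Qed.

Lemma compatible_exists_direct p q : (m.*2 < d)%N ->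
  exists2 s, compatible p q s & \prod_i s i = 1.
Proof.
move=> lt_m2d; have [s [s1 hs]] := compatible_exists p q.
have md : (m < d)%N by move: lt_m2d; lia.
(* since 2m < d, coordinate m is neither sheared nor the partner of a sheared
   coordinate, so its sign is free *)
pose o := Ordinal md.
have ro : (m <= rev_ord o)%N by rewrite /=; move: lt_m2d; lia.
pose D := \prod_i s i.
have D1 : D = 1 \/ D = -1 by exact: prod_sign.
exists (fun i => if i == o then D * s o else s i).
  split=> i.
    case: ifP => _ //; have [->|->] := s1 o; case: D1 => ->; auto.
  move=> im n hn.
  have /negPf-> : i != o by apply/eqP => io; move: im; rewrite io /= ltnn.
  have /negPf-> : rev_ord i != o.
    apply/eqP => io; move: im; rewrite -(rev_ordK i) io.
    by rewrite ltnNge ro.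
  exact: hs.
have DE : D = s o * \prod_(i | i != o) s i by rewrite /D (bigD1 o).
rewrite (bigD1 o)//= eqxx (eq_bigr s) => [|i /negPf->//].
by rewrite -mulrA -DE; case: D1 => ->.
Qed.

Lemma sheared_tiling_monocoronal : monocoronal_up_to_congruence sheared_tiling.
Proof.
move=> _ _ /sheared_tiling_vertex_int[p ->] /sheared_tiling_vertex_int[q ->].
have [s cpt] := compatible_exists p q.
by apply: (compatible_congruent cpt); apply: signmx_orthogonal; exact: cpt.1.
Qed.

Lemma sheared_tiling_monocoronal_direct :
  (m.*2 < d)%N -> monocoronal_up_to_rigid_motions sheared_tiling.
Proof.
move=> lt_m2d _ _ /sheared_tiling_vertex_int[p ->]
  /sheared_tiling_vertex_int[q ->].
have [s cpt s1] := compatible_exists_direct p q lt_m2d.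
apply: (compatible_congruent cpt); split.
  by apply: signmx_orthogonal; exact: cpt.1.
by rewrite det_signmx s1.
Qed.

(** * Periods *)

Lemma translation_isometry (v : 'rV[R]_d) : euclidean_isometry (translation v).
Proof. by move=> x y; rewrite /translation opprD addrACA subrr add0r. Qed.

(** Integer translations that fix the partner coordinates preserve the
    slopes. *)
Lemma translate_tile c (a : 'rV[int]_d) :
  (forall i, (i < m)%N -> a 0 (rev_ord i) = 0) ->
  translation (intpt a) @` tile c = tile (c + a).
Proof.
move=> a0.
have sE i : shear (c + a) i = shear c i.
  by rewrite /shear; case: ifP => // im; rewrite mxE a0// addr0.
have E z i : lcoord (c + a) (translation (intpt a) z) i = lcoord c z i.
  by rewrite /lcoord sE /translation !mxE !rmorphD /=; ring.
apply/seteqP; split => [_ [z tz <-] i|z tz]; first by rewrite E.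
exists (z - intpt a); last by rewrite /translation addrC subrK.
move=> i; rewrite -E /translation [_ + (_ - _)]addrC subrK; exact: tz.
Qed.

Lemma translation_sheared_tiling (a : 'rV[int]_d) :
  (forall i, (i < m)%N -> a 0 (rev_ord i) = 0) ->
  symmetry_group sheared_tiling (translation (intpt a)).
Proof.
move=> a0; split; first exact: translation_isometry.
apply/seteqP; split=> [_ [_ [c _ <-] <-]|_ [c _ <-]].
  by rewrite translate_tile//; exists (c + a).
exists (tile (c - a)); first by exists (c - a).
by rewrite translate_tile// subrK.
Qed.

(** A period of the tiling moves the partner coordinate of i by an integer that
    is a period of slope, hence by 0. *)
Lemma translation_sheared_tiling_partner v i : (i < m)%N ->
  symmetry_group sheared_tiling (translation v) -> v 0 (rev_ord i) = 0.
Proof.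
move=> im [_ E]; set j := rev_ord i.
have mj : (m <= j)%N by exact: rev_ltm.
have ij : (j == i) = false by apply/eqP => e; move: mj; rewrite e leqNgt im.
have key n : exists2 N : int, v 0 j = N%:~R & slope (n + N) = slope n.
  pose c : 'rV[int]_d := const_mx n.
  have [c' _ Ec] : sheared_tiling (translation v @` tile c).
    by rewrite -E; exists (tile c) => //; exists c.
  (* the translates of the corners of the tile c lie in the tile c' *)
  have h (e : 'I_d -> bool) k :
      0 <= lcoord c' (v + tpoint c (\row_i (e i)%:R)) k <= 1.
    suff: tile c' (v + tpoint c (\row_i (e i)%:R)) by [].
    rewrite Ec; exists (tpoint c (\row_i (e i)%:R)) => //.
    by apply: tile_tpoint => l; rewrite mxE; case: (e l);
      rewrite /= ?lexx ler01.
  have cj : shear c j = 0 by exact: shear0.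
  have ci : shear c i = slope n by rewrite /shear im mxE.
  have ci' : shear c' i = slope (c' 0 j) by rewrite /shear im.
  have vj : v 0 j = (c' 0 j - n)%:~R.
    have := h (fun=> false) j; have := h (fun=> true) j.
    by rewrite !lcoord_unsheared// !mxE cj /= intrB; lra.
  exists (c' 0 j - n) => //; rewrite addrC subrK -ci' -ci.
  have := h (fun=> false) i; have := h (fun k => k == i) i.
  have := h (fun k => k == j) i; have := h (fun k => (k == i) || (k == j)) i.
  rewrite /lcoord -/j !mxE !rev_ordK -/j cj vj !eqxx ij [i == j]eq_sym ij /=.
  rewrite intrB => h1 h2 h3 h4.
  by apply: (@intr_inj R); lra.
have [N vN _] := key 0; rewrite vN.
suff -> : N = 0 by [].
apply: slope_aperiodic => n; have [N' vN' <-] := key n.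
by congr (slope (n + _)); apply: (@intr_inj R); rewrite -vN -vN'.
Qed.

Lemma sheared_tiling_periodic : k_periodic (d - m) sheared_tiling.
Proof.
have md : (m <= d)%N by move: m2d; lia.
split.
  exists (pid_mx (d - m)); split.
    by rewrite /row_free rank_pid_mx// leq_subr.
  move=> i.
  have -> : row i (pid_mx (d - m)) =
      intpt (\row_j ((i == j :> nat) && (i < d - m)%N)%:R).
    by apply/rowP => j; rewrite !mxE; case: (_ && _).
  apply: translation_sheared_tiling => k km; rewrite mxE.
  case: eqP => //= ik; move: (ltn_ord i); rewrite ik /=.
  by have := ltn_ord k; lia.
move=> n V [/eqP rV symV].
(* the last m columns of V vanish, so V factors through R^(d - m) *)
have VE : V = (\matrix_(i, j) V i (widen_ord (leq_subr m d) j)) *m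
              (pid_mx (d - m) : 'M[R]_(d - m, d)).
  apply/matrixP => i j; rewrite mxE.
  have [jd|jd] := ltnP j (d - m).
    rewrite (bigD1 (Ordinal jd))//= !mxE /= eqxx jd mulr1 big1 ?addr0.
      by congr (V i _); apply: val_inj.
    move=> k kj; rewrite !mxE; case: eqP => [e|]; last by rewrite mulr0.
    by move: kj; rewrite -val_eqE /= e eqxx.
  rewrite big1 => [|k _]; last first.
    rewrite !mxE; case: eqP => [e|]; last by rewrite mulr0.
    by have := ltn_ord k; rewrite e ltnNge jd.
  have jm : (rev_ord j < m)%N by rewrite /=; have := ltn_ord j; lia.
  have := translation_sheared_tiling_partner jm (symV i).
  by rewrite rev_ordK mxE.
by rewrite -rV VE (leq_trans (mxrankM_maxr _ _))// rank_leq_row.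
Qed.

End ShearedTiling.

Theorem theorem3p1 (R : realType) (d : nat) (hd : (3 <= d)%N) :
  (exists TT : set (set 'rV[R]_d),
     [/\ face_to_face_polytope_tiling TT,
         k_periodic (uphalf d) TT
       & monocoronal_up_to_congruence TT]) /\
  (exists TT : set (set 'rV[R]_d),
     [/\ face_to_face_polytope_tiling TT,
         k_periodic (uphalf d.+1) TT
       & monocoronal_up_to_rigid_motions TT]).
Proof.
split.
  have hm : (d./2.*2 <= d)%N by lia.
  exists (sheared_tiling (R := R) (d := d) d./2); split.
  - exact: sheared_tiling_polytope_tiling.
  - have -> : uphalf d = (d - d./2)%N by lia.
    exact: sheared_tiling_periodic.
  - exact: sheared_tiling_monocoronal.
have hm : (d.-1./2.*2 < d)%N by lia.
exists (sheared_tiling (R := R) (d := d) d.-1./2); split.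
- exact/sheared_tiling_polytope_tiling/ltnW.
- have -> : uphalf d.+1 = (d - d.-1./2)%N by lia.
  exact/sheared_tiling_periodic/ltnW.
- exact: sheared_tiling_monocoronal_direct (ltnW hm) hm.
Qed.
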